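(* The Toda equations $$\exp\Big(F(x_0+\lambda)+F(x_0-\lambda)-2F\Big)=\lambda^2F_{y_0y_0}$$ determine the Gromov-Witten potential $F$ of $\mathbf{P}^1$ from the degree $0$ potential $F|_{d=0}$.
   Context: Let $x$ and $y$ be the unit and the K\''ahler (point) class in the cohomology of $\mathbf{P}^1$. For $g,d,n\ge 0$, $a_i\ge 0$ and $\gamma_i\in\{x,y\}$, the descendent Gromov-Witten invariants of $\mathbf{P}^1$ are $$\langle \tau_{a_1}(\gamma_1)\cdots\tau_{a_n}(\gamma_n)\rangle^{\mathbf{P}^1}_{g,d}=\int_{[\overline{M}_{g,n}(\mathbf{P}^1,d)]^{vir}}\prod_{i=1}^n \psi_i^{a_i}\cup \mathrm{ev}_i^*(\gamma_i),$$ where $\overline{M}_{g,n}(\mathbf{P}^1,d)$ is the moduli space of genus $g$, $n$-pointed, degree $d$ stable maps to $\mathbf{P}^1$, $\psi_i$ is the first Chern class of the $i$-th cotangent line bundle, and $\mathrm{ev}_i$ is the $i$-th evaluation map. Let $x_i,y_i$ ($i\ge 0$) be formal variables (the coordinates on the large phase space) and let $\gamma=\sum_{i\ge 0}x_i\tau_i(x)+y_i\tau_i(y)$. The Gromov-Witten potential is $$F(\lambda,x_i,y_i)=\sum_{g\ge 0}\lambda^{2g-2}F^g(x_i,y_i),\qquad F^g=\sum_{d\ge 0}\sum_{n\ge 0}\frac{1}{n!}\langle\gamma^n\rangle^{\mathbf{P}^1}_{g,d},$$ and $F|_{d=0}$ denotes the part of $F$ coming from the degree $d=0$ invariants. In the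 Toda equations, $F(x_0\pm\lambda)=F(\lambda,x_0\pm\lambda,x_1,\ldots,y_0,\ldots)$, and $F_{y_0y_0}$ is the second partial derivative in $y_0$. Equivalently, they may be written as $$\exp\Big(\sum_{k>0}\frac{2\lambda^{2k}}{(2k)!}\frac{\partial^{2k}F}{\partial x_0^{2k}}\Big)=\lambda^2F_{y_0y_0}.$$ That $F$ satisfies the Toda equations is conjectural in the paper: it is proven there in genus $0$ and $1$ and stated to be unproven for genus $g\ge 2$. *)

(* Defs.v *)
From mathcomp Require Export all_boot all_order all_algebra all_fingroup.
From mathcomp Require Export finmap multiset classical_sets fsbigop.

Set Implicit Arguments.
Unset Strict Implicit.
Unset Printing Implicit Defensive.
Import GRing.Theory.

Local Open Scope classical_set_scope.
Local Open Scope ring_scope.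

(* Mbar_{g,n}(P^1,d) is nonempty (equivalently, the point n+1 can be forgotten
   on Mbar_{g,n+1}(P^1,d)) iff d > 0 or 2g-2+n > 0. *)
Definition stable (g n d : nat) : bool := (0 < d)%N || (2 < 2 * g + n)%N.

(* The intersection theory of the spaces Mbar_{g,n}(P^1,d), seen through the
   following standard facts.
   - [coh g n d] is the even rational cohomology ring of Mbar_{g,n}(P^1,d) (the
     zero ring when this space is empty), [of_deg k] the predicate of being
     homogeneous of complex degree k, [vint] the integral over the virtual
     fundamental class, of complex dimension 2g-2+2d+n.
   - H^*(P^1) = Q[y]/(y^2), so that ev_i^* is given by the square-zero class
     [evpt i] = ev_i^*(y).
   - [relabel s] is the action on cohomology of the renumbering s of the
     markings.
   - [forget] is the pullback pi^* by the morphism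
     Mbar_{g,n+1}(P^1,d) -> Mbar_{g,n}(P^1,d) forgetting the last marking, and
     [sec i] is the class of the image of the i-th section of pi, i.e. of the
     boundary divisor where the markings i and n+1 lie alone on a contracted
     rational component.  The last two fields are the projection formula for
     the sections and for pi, as [Mbar_{g,n+1}]^vir = pi^*[Mbar_{g,n}]^vir and
     pi_*(ev_{n+1}^* y) = d. *)
Record stable_map_theory := StableMapTheory {
  coh : nat -> nat -> nat -> comPzRingType;
  of_deg : forall g n d, nat -> coh g n d -> Prop;
  psi : forall g n d, 'I_n -> coh g n d;
  evpt : forall g n d, 'I_n -> coh g n d;
  vint : forall g n d, {additive coh g n d -> rat};
  relabel : forall g n d, 'S_n -> {rmorphism coh g n d -> coh g n d};
  forget : forall g n d, stable g n d ->
    {rmorphism coh g n d -> coh g n.+1 d};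
  sec : forall g n d, 'I_n -> coh g n.+1 d;

  coh_empty : forall g n d, ~~ stable g n d -> 1 = 0 :> coh g n d;

  deg_one : forall g n d, @of_deg g n d 0 1;
  deg_mul : forall g n d k l (a b : coh g n d),
    of_deg k a -> of_deg l b -> of_deg (k + l) (a * b);
  deg_psi : forall g n d (i : 'I_n), of_deg 1 (psi g d i);
  deg_evpt : forall g n d (i : 'I_n), of_deg 1 (evpt g d i);
  vint_dim : forall g n d k (a : coh g n d),
    of_deg k a -> (k + 2 != 2 * g + 2 * d + n)%N -> vint g n d a = 0;

  evpt_sqr : forall g n d (i : 'I_n), evpt g d i ^+ 2 = 0;

  relabel_psi : forall g n d (s : 'S_n) (i : 'I_n),
    relabel g d s (psi g d i) = psi g d (s i);
  relabel_evpt : forall g n d (s : 'S_n) (i : 'I_n),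
    relabel g d s (evpt g d i) = evpt g d (s i);
  vint_relabel : forall g n d (s : 'S_n) (a : coh g n d),
    vint g n d (relabel g d s a) = vint g n d a;

  forget_evpt : forall g n d (st : stable g n d) (i : 'I_n),
    evpt g d (widen_ord (leqnSn n) i) = forget st (evpt g d i);
  forget_psi : forall g n d (st : stable g n d) (i : 'I_n),
    psi g d (widen_ord (leqnSn n) i) = forget st (psi g d i) + sec g d i;
  sec_psi : forall g n d, stable g n d -> forall i : 'I_n,
    sec g d i * psi g d (widen_ord (leqnSn n) i) = 0;
  sec_evpt : forall g n d, stable g n d -> forall i : 'I_n,
    sec g d i * evpt g d ord_max =
    sec g d i * evpt g d (widen_ord (leqnSn n) i);
  sec_disjoint : forall g n d, stable g n d -> forall i j : 'I_n,
    i != j -> sec g d i * sec g d j = 0;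
  vint_sec : forall g n d (st : stable g n d) (i : 'I_n) (a : coh g n d),
    vint g n.+1 d (sec g d i * forget st a) = vint g n d a;
  vint_forget_evpt : forall g n d (st : stable g n d) (a : coh g n d),
    vint g n.+1 d (forget st a * evpt g d ord_max) = d%:R * vint g n d a
}.

(* (a, false) stands for tau_a(x), and (a, true) for tau_a(y); these also index
   the variables x_a and y_a. *)
Definition insertion : choiceType := (nat * bool)%type.
Definition tau_x (a : nat) : insertion := (a, false).
Definition tau_y (a : nat) : insertion := (a, true).

Definition evpull (M : stable_map_theory) g n d (i : 'I_n) (c : bool) :
  coh M g n d := if c then evpt M g d i else 1.

(* < tau_{a_1}(gamma_1) ... tau_{a_n}(gamma_n) >_{g,d} *)
Definition descendent (M : stable_map_theory) (g d : nat)
    (s : seq insertion) : rat :=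
  vint M g (size s) d
    (\prod_(i < size s)
       (psi M g d i ^+ (tnth (in_tuple s) i).1 *
        evpull M g d i (tnth (in_tuple s) i).2)).

(* Monomials in the x_i, y_i are finite multisets of variables.  A series in
   lambda and the x_i, y_i is given by its coefficients: [F e m] is that of
   lambda^e * m. *)
Definition monomial : choiceType := {mset insertion}%mset.
Definition series : Type := int -> monomial -> rat.

(* The sums [\sum_(i \in A)] below have finite support: lambda-exponents are
   bounded below in all the series involved, and the degree d is determined by
   g and the insertions. *)

(* Coefficient of m in sum_n <gamma^n>_{g,d} / n!, the bracket being expanded by
   multilinearity over the words of length n in the insertions. *)
Definition potential_gd (M : stable_map_theory) (g d : nat) (m : monomial) :
    rat :=
  \sum_(s \in [set s : seq insertion | seq_mset s = m])
    ((size s)`!%:R)^-1 * descendent M g d s.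

Definition potential_g (M : stable_map_theory) (g : nat) (m : monomial) : rat :=
  \sum_(d \in [set: nat]) potential_gd M g d m.

Definition potential (M : stable_map_theory) : series := fun e m =>
  \sum_(g \in [set g : nat | 2 * g%:Z - 2 = e]) potential_g M g m.

Definition potential_deg0 (M : stable_map_theory) : series := fun e m =>
  \sum_(g \in [set g : nat | 2 * g%:Z - 2 = e]) potential_gd M g 0 m.

Definition series_mul (A B : series) : series := fun e m =>
  \sum_(p \in [set p : (int * monomial) * (int * monomial) |
                 p.1.1 + p.2.1 = e /\ (p.1.2 `+` p.2.2)%mset = m])
    A p.1.1 p.1.2 * B p.2.1 p.2.2.

Definition series_one : series := fun e m =>
  ((e == 0) && (m == mset0))%:R.

(* Meant for series without negative powers of lambda and without constant
   term, as is the exponent in the Toda equations. *)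
Definition series_exp (A : series) : series := fun e m =>
  \sum_(j \in [set: nat]) (j`!%:R)^-1 * iter j (series_mul A) series_one e m.

Definition deriv (v : insertion) (F : series) : series := fun e m =>
  ((m v).+1)%:R * F e (v +` m)%mset.

Definition mul_lambda2 (F : series) : series := fun e m => F (e - 2) m.

(* F(x_0 + c lambda): a monomial x_0^(k+j) contributes
   'C(k+j, j) (c lambda)^j x_0^k. *)
Definition shift_x0 (c : rat) (F : series) : series := fun e m =>
  \sum_(j \in [set: nat])
    c ^+ j * ('C(m (tau_x 0) + j, j))%:R *
    F (e - j%:Z) (msetn j (tau_x 0) `+` m)%mset.

Definition toda (F : series) : Prop :=
  forall e m,
    series_exp (fun e' m' =>
      shift_x0 1 F e' m' + shift_x0 (-1) F e' m' - 2 * F e' m') e m =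
    mul_lambda2 (deriv (tau_y 0) (deriv (tau_y 0) F)) e m.

(* Main.v *)
(* Weigh lambda, x_a, y_a by -1, a - 1, a: by the dimension constraint, the
   degree d part of the potential is the part of weight 2d.  Both d/dy_0 and the
   shifts of x_0 by multiples of lambda preserve the weight, so the factor
   lambda^2 in the Toda equations makes F_{y_0 y_0} in degree d a function of F
   in degrees < d.  For d > 0, two applications of the divisor equation, by
   induction on the total power of the psi classes, then recover the degree d
   part of F from that of F_{y_0 y_0}. *)

Require Import Defs.
From mathcomp Require Import zify boolp.

Set Implicit Arguments.
Unset Strict Implicit.
Unset Printing Implicit Defensive.
Import Order.TTheory GRing.Theory Num.Theory.

Local Open Scope classical_set_scope.
Local Open Scope ring_scope.

(** * Preliminaries on lists and products *)

Lemma set_nth_catl (T : Type) (x0 : T) s s' i y : (i < size s)%N ->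
  set_nth x0 (s ++ s') i y = set_nth x0 s i y ++ s'.
Proof. by elim: s i => [|x s IHs] [|i] //= /IHs ->. Qed.

(** In the expanded product every term with two or more factors [B] vanishes. The [B i] will be
    multiples of the classes of pairwise disjoint sections. *)
Lemma prodrD_orthogonal (R : comPzRingType) (I : finType) (A B : I -> R) :
  (forall i j, i != j -> B i * B j = 0) ->
  \prod_i (A i + B i) = \prod_i A i + \sum_i B i * \prod_(j | j != i) A j.
Proof.
move=> BB0; have := index_enum_uniq I; elim: (index_enum I) => [|x r IHr] /=.
  by rewrite !big_nil addr0.
case/andP=> xr /IHr{}IHr; rewrite !big_cons eqxx IHr /= mulrDl !mulrDr.
have -> : B x * (\sum_(i <- r) B i * \prod_(j <- r | j != i) A j) = 0.
  rewrite mulr_sumr big_seq big1 // => i ir.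
  by rewrite mulrA BB0 ?mul0r //; apply: contraNneq xr => ->.
have -> : \prod_(j <- r | j != x) A j = \prod_(j <- r) A j.
  rewrite big_seq_cond [RHS]big_seq; apply: eq_bigl => i.
  by case: (boolP (i \in r)) => //= ir; apply: contraNneq xr => <-.
rewrite addr0 -addrA; congr (_ + _); rewrite addrC; congr (_ + _).
rewrite mulr_sumr !big_seq; apply: eq_bigr => i ir.
rewrite big_cons ifT 1?mulrCA //.
by apply: contraNneq xr => ->.
Qed.

(** * Descendent invariants and the divisor equation *)

Section Descendents.

Variables (M : stable_map_theory) (g d : nat).

Definition insertion_class n (i : 'I_n) (v : insertion) : coh M g n d :=
  psi M g d i ^+ v.1 * evpull M g d i v.2.

Lemma descendentE x0 s n : size s = n ->
  descendent M g d s =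
  vint M g n d (\prod_(i < n) insertion_class i (nth x0 s i)).
Proof.
move=> <-; rewrite /descendent; congr (vint _ _ _ _ _).
by apply: eq_bigr => i _; rewrite /insertion_class (tnth_nth x0).
Qed.

Lemma descendent_perm s s' :
  perm_eq s s' -> descendent M g d s = descendent M g d s'.
Proof.
move=> ss'; have [p def_s] := @tuple_permP _ (size s') s (in_tuple s') ss'.
rewrite (@descendentE (tau_x 0) s (size s')) ?(perm_size ss') //.
(* As [s] lists the entries of [s'] along [p], the marking of [s] that carries the [i]-th entry of
   [s'] is [p^-1 i]; hence the renumbering by [p^-1]. *)
rewrite (@descendentE (tau_x 0) s' (size s')) // -[RHS](vint_relabel p^-1).
rewrite (reindex_inj (@perm_inj _ p^-1)) rmorph_prod /=.
congr (vint _ _ _ _ _); apply: eq_bigr => i _.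
rewrite rmorphM rmorphXn /= relabel_psi /evpull.
rewrite def_s nth_mktuple permKV (tnth_nth (tau_x 0)) /insertion_class /evpull.
by case: (_).2; rewrite ?relabel_evpt ?rmorph1.
Qed.

(** The boolean [v.2] is coerced to 0 or 1, the complex degree of the class pulled back from the
    target. *)
Lemma insertion_class_deg n (i : 'I_n) (v : insertion) :
  of_deg (v.1 + v.2) (insertion_class i v).
Proof.
apply: deg_mul; last by case: v.2; [exact: deg_evpt | exact: deg_one].
elim: v.1 => [|k IHk]; first exact: deg_one.
by rewrite exprS -add1n; apply: deg_mul => //; exact: deg_psi.
Qed.

Lemma descendent_dim s :
  (\sum_(v <- s) ((v : insertion).1 + v.2) + 2 != 2 * g + 2 * d + size s)%N ->
  descendent M g d s = 0.
Proof.
apply: vint_dim; rewrite big_tnth.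
apply: (big_rec2 (fun k a => of_deg k a)); first exact: deg_one.
by move=> i k a _ ?; apply: deg_mul => //; exact: insertion_class_deg.
Qed.


Hypothesis d_gt0 : (0 < d)%N.

(** In positive degree the last marking can always be forgotten, with no exceptional small [g] and
    [n]. *)
Let st n : stable g n d.
Proof. by rewrite /stable d_gt0. Qed.

(* On the boundary divisor [sec i] the class psi_i vanishes, so in
   (pi^*psi_i + sec i)^a only one cross term survives. *)
Lemma insertion_class_forget n (i : 'I_n) (v : insertion) :
  insertion_class (widen_ord (leqnSn n) i) v =
  forget M (st n) (insertion_class i v) +
  sec M g d i * forget M (st n)
    (if (0 < v.1)%N then insertion_class i (v.1.-1, v.2) else 0).
Proof.
have psi_pow a : psi M g d (widen_ord (leqnSn n) i) ^+ a =
    forget M (st n) (psi M g d i ^+ a) +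
    sec M g d i * forget M (st n)
      (if (0 < a)%N then psi M g d i ^+ a.-1 else 0).
  elim: a => [|[|a] IHa] /=; first by rewrite !expr0 rmorph1 rmorph0 mulr0 addr0.
    by rewrite !expr1 expr0 rmorph1 mulr1 (forget_psi _ (st n)).
  rewrite exprSr {2}(forget_psi _ (st n)) mulrDr {2}exprSr -mulrA.
  rewrite [_ * sec M g d i]mulrC (sec_psi M (st n)) mulr0 addr0 IHa /=.
  by rewrite mulrDl -rmorphM -exprSr -mulrA -rmorphM -exprSr.
rewrite /insertion_class psi_pow mulrDl.
have -> : evpull M g d (widen_ord (leqnSn n) i) v.2 =
          forget M (st n) (evpull M g d i v.2).
  by rewrite /evpull; case: v.2; rewrite ?rmorph1 ?(forget_evpt _ (st n)).
rewrite -rmorphM -mulrA -rmorphM; congr (_ + _ * forget _ _ _).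
by case: ifP => //; rewrite mul0r.
Qed.

Lemma insertion_class_evpt n (i : 'I_n) (v : insertion) :
  insertion_class i v * evpt M g d i =
  if v.2 then 0 else insertion_class i (v.1, true).
Proof.
rewrite /insertion_class -mulrA /evpull /=; case: v.2; last by rewrite mul1r.
by rewrite -expr2 evpt_sqr mulr0.
Qed.

(** The insertions that yield a correction term: there must be a psi class to lower, and y^2 = 0
    kills the term of an insertion that already carries y. *)
Definition divisor_correction (v : insertion) : bool := (0 < v.1)%N && ~~ v.2.

(** Each factor is a pullback plus a multiple of a section class. The product of the pullbacks gives
    the factor [d] by the projection formula; since the sections are disjoint, the rest is one
    correction per marking. *)
Lemma divisor_equation s :
  descendent M g d (rcons s (tau_y 0)) =
  d%:R * descendent M g d s +
  \sum_(i < size s | divisor_correction (nth (tau_y 0) s i))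
    descendent M g d
      (set_nth (tau_y 0) s i ((nth (tau_y 0) s i).1.-1, true)).
Proof.
rewrite (@descendentE (tau_y 0) _ (size s).+1) ?size_rcons // big_ord_recr /=.
set n := size s; set t := nth (tau_y 0) s.
have -> : insertion_class ord_max (nth (tau_y 0) (rcons s (tau_y 0)) n) =
          evpt M g d (@ord_max n).
  by rewrite nth_rcons ltnn eqxx /insertion_class expr0 mul1r.
pose A (i : 'I_n) := forget M (st n) (insertion_class i (t i)).
pose C (i : 'I_n) := if (0 < (t i).1)%N then
  insertion_class i ((t i).1.-1, (t i).2) else 0.
rewrite (eq_bigr (fun i => A i + sec M g d i * forget M (st n) (C i))); last first.
  by move=> i _; rewrite nth_rcons ltn_ord -/t insertion_class_forget.
rewrite prodrD_orthogonal; last first.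
  by move=> i j ij; rewrite mulrACA (sec_disjoint _ (st n) ij) mul0r.
rewrite mulrDl mulr_suml raddfD raddf_sum /=; congr (_ + _).
  rewrite -rmorph_prod vint_forget_evpt.
  by rewrite (@descendentE (tau_y 0) s n).
rewrite [RHS]big_mkcond /=; apply: eq_bigr => i _.
(* On the [i]-th section the last evaluation class may be replaced by the pullback of the [i]-th
   one. Everything but [sec] is then a pullback and [vint_sec] applies. *)
rewrite -rmorph_prod mulrAC [_ * evpt M g d _]mulrAC (sec_evpt _ (st n)).
rewrite (forget_evpt _ (st n)) -[sec _ _ _ _ * _ * _]mulrA -rmorphM.
rewrite -mulrA -rmorphM vint_sec /divisor_correction {}/C.
case: ifP => /= [_|_]; last by rewrite mulr0 mul0r raddf0.
rewrite [evpt _ _ _ _ * _]mulrC insertion_class_evpt /=.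
case: ifP => _ /=; first by rewrite mul0r raddf0.
have sz : size (set_nth (tau_y 0) s i ((t i).1.-1, true)) = n.
  by rewrite size_set_nth; apply/maxn_idPr.
rewrite (descendentE (tau_y 0) sz) [in RHS](bigD1 i) //=.
rewrite nth_set_nth /= eqxx; congr (vint _ _ _ _ (_ * _)).
apply: eq_bigr => j ij; rewrite nth_set_nth /= ifN //.
Qed.

End Descendents.

(** The divisor equation is solved for the invariant with one [tau_y 0] fewer: its coefficient [d]
    is nonzero, and every correction has smaller total psi power, which allows induction. *)
Lemma descendent_divisor_eq (M M' : stable_map_theory) g d k :
  (0 < d)%N ->
  (forall s, descendent M g d (s ++ nseq k.+1 (tau_y 0)) =
             descendent M' g d (s ++ nseq k.+1 (tau_y 0))) ->
  forall s, descendent M g d (s ++ nseq k (tau_y 0)) =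
            descendent M' g d (s ++ nseq k (tau_y 0)).
Proof.
move=> d_gt0 eqS s; have [N] := ubnP (\sum_(v <- s) (v : insertion).1)%N.
elim: N s => // N IHN s; rewrite ltnS => sN.
have := eqS s; rewrite -[k.+1]addn1 nseqD catA cats1 !divisor_equation //.
(* The corrections for [M'] are identified with those for [M] by induction and cancelled. *)
rewrite [X in _ = _ + X -> _](_ : _ = \sum_(i < size (s ++ nseq k (tau_y 0)) |
  divisor_correction (nth (tau_y 0) (s ++ nseq k (tau_y 0)) i))
    descendent M g d
      (set_nth (tau_y 0) (s ++ nseq k (tau_y 0)) i
        ((nth (tau_y 0) (s ++ nseq k (tau_y 0)) i).1.-1, true))).
  move/addIr; apply: mulfI; rewrite pnatr_eq0 -lt0n //.
apply: eq_bigr => i; rewrite nth_cat; case: ltnP => [i_s | _]; last first.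
  (* The trailing [tau_y 0] carry no psi class, hence give no correction. *)
  by rewrite nth_nseq if_same.
set v := nth _ s i => /andP[v_gt0 _].
have -> : set_nth (tau_y 0) (s ++ nseq k (tau_y 0)) i (v.1.-1, true) =
          set_nth (tau_y 0) s i (v.1.-1, true) ++ nseq k (tau_y 0).
  by rewrite set_nth_catl.
apply/esym/IHN; apply: leq_trans sN.
rewrite set_nthE i_s -[s in ltnRHS](cat_take_drop i) (drop_nth (tau_y 0) i_s).
by rewrite !big_cat !big_cons /= ltn_add2l ltn_add2r prednK.
Qed.

(** * The weight grading and the Toda equations *)

Definition weight (e : int) (m : monomial) : int :=
  \sum_(v <- enum_mset m) (((v : insertion).1 + v.2)%:Z - 1) - e.

Lemma weight_seq e s :
  weight e (seq_mset s) =
  (\sum_(v <- s) ((v : insertion).1 + v.2))%N%:Z - (size s)%:Z - e.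
Proof.
rewrite /weight (perm_big _ (perm_eq_seq_mset s)) sumrB; congr (_ - _ - _).
  by rewrite (big_morph Posz PoszD (erefl _)).
by rewrite big_const_seq count_predT iter_addr_0 natz.
Qed.

Lemma weightD e e' m m' :
  weight (e + e') (m `+` m')%mset = weight e m + weight e' m'.
Proof.
rewrite /weight opprD addrACA -big_cat; congr (_ + _).
apply: perm_big; apply/allP => v _ /=.
by rewrite count_cat !count_mem_mset msetE2.
Qed.

(** Both lambda and x_0 have weight -1, so trading one for the other changes nothing. *)
Lemma weight_x0 e m j :
  weight (e - j%:Z) (msetn j (tau_x 0) `+` m)%mset = weight e m.
Proof.
rewrite addrC weightD /weight enum_msetn big_nseq iter_addr_0 opprK /=.
by rewrite sub0r mulNrn -natz addNr add0r.
Qed.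

(** Congruence modulo terms of weight at least [N]; for series of nonnegative weight it is
    compatible with products. *)
Definition agree_below (N : nat) (F F' : series) :=
  forall e m, weight e m < N%:Z -> F e m = F' e m.

Definition nonneg_weight (F : series) :=
  forall e m, weight e m < 0 -> F e m = 0.

Lemma nonneg_weight_mul A B :
  nonneg_weight A -> nonneg_weight B -> nonneg_weight (series_mul A B).
Proof.
move=> A0 B0 e m em; rewrite /series_mul fsbig1 // => -[[e1 m1] [e2 m2]] /=.
move=> [def_e def_m]; move: em; rewrite -def_e -def_m weightD.
have [/A0 -> | A_ge0] := ltP (weight e1 m1) 0; first by rewrite mul0r.
have [/B0 -> | B_ge0] := ltP (weight e2 m2) 0; first by rewrite mulr0.
by rewrite ltNge addr_ge0.
Qed.

(** When both weights are nonnegative, each is bounded by their sum, hence lies below [N]. The sums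
    are compared term by term, so their supports do not matter. *)
Lemma agree_below_mul N A A' B B' :
  nonneg_weight A -> nonneg_weight A' -> nonneg_weight B -> nonneg_weight B' ->
  agree_below N A A' -> agree_below N B B' ->
  agree_below N (series_mul A B) (series_mul A' B').
Proof.
move=> A0 A0' B0 B0' AA' BB' e m em.
apply: eq_fsbigr => -[[e1 m1] [e2 m2]]; rewrite inE /= => -[def_e def_m].
move: em; rewrite -def_e -def_m weightD.
have [w1 | A_ge0] := ltP (weight e1 m1) 0; first by rewrite A0 // A0' // !mul0r.
have [w2 | B_ge0] := ltP (weight e2 m2) 0; first by rewrite B0 // B0' // !mulr0.
move=> w12; rewrite AA' ?BB' //; apply: le_lt_trans w12.
  by rewrite lerDr.
by rewrite lerDl.
Qed.

Lemma weight0 : weight 0 mset0 = 0.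
Proof. by rewrite /weight enum_mset0 big_nil subr0. Qed.

Lemma nonneg_weight_one : nonneg_weight series_one.
Proof.
move=> e m; rewrite /series_one; case: eqP => [-> | //] /=.
by case: eqP => [-> | //]; rewrite weight0 ltxx.
Qed.

Lemma nonneg_weight_iter A j :
  nonneg_weight A -> nonneg_weight (iter j (series_mul A) series_one).
Proof.
move=> A0; elim: j => [|j IHj] /=; first exact: nonneg_weight_one.
exact: nonneg_weight_mul.
Qed.

Lemma agree_below_exp N A A' :
  nonneg_weight A -> nonneg_weight A' -> agree_below N A A' ->
  agree_below N (series_exp A) (series_exp A').
Proof.
move=> A0 A0' AA' e m em; apply: eq_fsbigr => j _; congr (_ * _).
elim: (j : nat) e m em => [|i IHi] //=.
by apply: agree_below_mul => //; exact: nonneg_weight_iter.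
Qed.

Lemma nonneg_weight_shift c F : nonneg_weight F -> nonneg_weight (shift_x0 c F).
Proof.
by move=> F0 e m em; apply: fsbig1 => j _; rewrite F0 ?mulr0 // weight_x0.
Qed.

Lemma agree_below_shift N c F F' :
  agree_below N F F' -> agree_below N (shift_x0 c F) (shift_x0 c F').
Proof.
by move=> FF' e m em; apply: eq_fsbigr => j _; rewrite FF' // weight_x0.
Qed.

Definition toda_exponent (F : series) : series := fun e m =>
  shift_x0 1 F e m + shift_x0 (-1) F e m - 2 * F e m.

Lemma nonneg_weight_exponent F :
  nonneg_weight F -> nonneg_weight (toda_exponent F).
Proof.
by move=> F0 e m em; rewrite /toda_exponent !nonneg_weight_shift // F0 //.
Qed.

Lemma agree_below_exponent N F F' :
  agree_below N F F' -> agree_below N (toda_exponent F) (toda_exponent F').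
Proof.
move=> FF' e m em; rewrite /toda_exponent FF' //.
by rewrite !(agree_below_shift _ FF').
Qed.

(** The exponential side in weight w involves [F] only in weights at most w. As y_0 has weight 0,
    the coefficient reached on the other side has weight w + 2: the factor lambda^2 is the gain. *)
Lemma toda_truncation N F F' :
  toda F -> toda F' -> nonneg_weight F -> nonneg_weight F' ->
  agree_below N F F' ->
  forall e m, weight e m < N%:Z ->
    F (e - 2) (tau_y 0 +` (tau_y 0 +` m))%mset =
    F' (e - 2) (tau_y 0 +` (tau_y 0 +` m))%mset.
Proof.
move=> tF tF' F0 F0' FF' e m em.
have := agree_below_exp (nonneg_weight_exponent F0) (nonneg_weight_exponent F0')
  (agree_below_exponent FF') em.
have /= -> := tF e m; have /= -> := tF' e m.
(* The two derivatives contribute positive integer multiplicities, which cancel over the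
   rationals. *)
have succ_neq0 k : k.+1%:R != 0 :> rat by rewrite pnatr_eq0.
by move/(mulfI (succ_neq0 _))/(mulfI (succ_neq0 _)).
Qed.

(** * Coefficients of the potential *)

(** The words with a given multiset of letters are the permutations of one of them, and all have the
    same invariant. The nonzero ratio lets invariants be recovered from coefficients. *)
Lemma potential_gd_seq M g d s :
  potential_gd M g d (seq_mset s) =
  (size (permutations s))%:R / (size s)`!%:R * descendent M g d s.
Proof.
rewrite /potential_gd.
have -> : [set t | seq_mset t = seq_mset s] = [set` permutations s].
  apply/seteqP; split=> t /=; rewrite mem_permutations.
    by move/eq_seq_msetP.
  by move=> ?; apply/eq_seq_msetP.
rewrite -fsbig_seq ?permutations_uniq // big_seq.
rewrite (eq_bigr (fun=> ((size s)`!%:R)^-1 * descendent M g d s)) => [|t].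
  by rewrite -big_seq big_const_seq count_predT iter_addr_0 -mulrA mulr_natl.
by rewrite mem_permutations => ts; rewrite (perm_size ts) (descendent_perm _ _ _ ts).
Qed.

Lemma permutations_ratio_neq0 (s : seq insertion) :
  (size (permutations s))%:R / (size s)`!%:R != 0 :> rat.
Proof.
rewrite mulf_neq0 ?invr_eq0 ?pnatr_eq0 -?lt0n ?fact_gt0 //.
by rewrite -has_predT; apply/hasP; exists s; rewrite ?mem_permutations.
Qed.

(** This is the dimension constraint: the insertions have total degree 2g - 2 + 2d + n, and the
    weight subtracts n and 2g - 2. *)
Lemma potential_gd_weight M g d m :
  weight (2 * g%:Z - 2) m != (2 * d)%:Z -> potential_gd M g d m = 0.
Proof.
rewrite -[m]seq_mset_id weight_seq potential_gd_seq => w_neq.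
rewrite descendent_dim ?mulr0 //; apply: contraNneq w_neq => dim.
lia.
Qed.

Lemma genus_of_exponent (g : nat) :
  [set h : nat | 2 * h%:Z - 2 = 2 * g%:Z - 2] = [set g].
Proof.
apply/seteqP; split=> h /=; last by move->.
by move/addIr/mulfI => /(_ isT) [].
Qed.

(** The exponent of lambda fixes the genus and the weight then fixes the degree, so a single term of
    the double sum survives. *)
Lemma potential_degree M g d m :
  weight (2 * g%:Z - 2) m = (2 * d)%:Z ->
  potential M (2 * g%:Z - 2) m = potential_gd M g d m.
Proof.
move=> w_d; rewrite /potential genus_of_exponent fsbig_set1 /potential_g -(fsbig_widen [set d]) ?fsbig_set1 //.
move=> k /= [_ k_d]; apply: potential_gd_weight; rewrite w_d.
by apply/eqP => -[/eqP]; rewrite eqn_mul2l => /eqP/esym.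
Qed.

Lemma potential_deg0E M g m :
  potential_deg0 M (2 * g%:Z - 2) m = potential_gd M g 0 m.
Proof.
by rewrite /potential_deg0 genus_of_exponent fsbig_set1.
Qed.

Lemma potential_eq0 M e m :
  (forall g d, e = 2 * g%:Z - 2 -> weight e m <> (2 * d)%:Z) ->
  potential M e m = 0.
Proof.
move=> w_neq; apply: fsbig1 => g /= def_e; apply: fsbig1 => d _.
by apply: potential_gd_weight; rewrite def_e; apply/eqP/(w_neq g)/esym.
Qed.

Lemma potential_nonneg_weight M : nonneg_weight (potential M).
Proof.
move=> e m em; apply: potential_eq0 => g d _ w_d.
by move: em; rewrite w_d.
Qed.

(** * Induction on the weight *)

Theorem proposition2 (M M' : stable_map_theory) :
  toda (potential M) -> toda (potential M') ->
  (forall e m, potential_deg0 M e m = potential_deg0 M' e m) ->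
  forall e m, potential M e m = potential M' e m.
Proof.
move=> tM tM' eq0.
suff agree N : agree_below N (potential M) (potential M').
  move=> e m; apply: (agree (absz (weight e m)).+1).
  by lia.
elim: N => [|N IHN] e m em.
  by rewrite !potential_nonneg_weight.
(* Outside the exponents 2g - 2 and the weights 2d both potentials vanish. *)
have [[g [d [def_e w_d]]] | no_gd] :=
  pselect (exists g d, e = 2 * g%:Z - 2 /\ weight e m = (2 * d)%:Z); last first.
  by rewrite !potential_eq0 // => g d def_e w_d; case: no_gd; exists g, d.
subst e; rewrite !(potential_degree _ w_d).
case: (posnP d) => [d0 | d_gt0]; first by rewrite d0 -!potential_deg0E.
rewrite -[m]seq_mset_id !potential_gd_seq; congr (_ * _).
(* Inverting the divisor equation twice reduces the claim to words ending in two [tau_y 0], whose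
   coefficients occur in F_{y_0 y_0}. *)
rewrite -[enum_mset m]cats0; apply: (@descendent_divisor_eq _ _ _ _ 0) => //.
apply: descendent_divisor_eq => // s.
set s2 := s ++ _.
(* The word [s] is now arbitrary; if its weight is wrong, both invariants vanish. *)
have [w_s | w_s] := eqVneq (weight (2 * g%:Z - 2) (seq_mset s2)) (2 * d)%:Z;
  last first.
  apply: (mulfI (permutations_ratio_neq0 s2)); rewrite -!potential_gd_seq.
  by rewrite !potential_gd_weight.
apply: (mulfI (permutations_ratio_neq0 s2)); rewrite -!potential_gd_seq.
rewrite -!(potential_degree _ w_s).
have def_s2 : seq_mset s2 = (tau_y 0 +` (tau_y 0 +` seq_mset s))%mset.
  by rewrite -!mset_cons; apply/eq_seq_msetP; rewrite /s2 perm_catC.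
rewrite def_s2; apply: (toda_truncation tM tM' _ _ IHN).
- exact: potential_nonneg_weight.
- exact: potential_nonneg_weight.
(* The Toda equation is used at exponent 2g, where [s] has weight 2d - 2; this is below [N] because
   2d < N + 1. *)
move: em w_s; rewrite w_d !weight_seq big_cat size_cat !big_cons big_nil /=.
lia.
Qed.
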